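(* Let $G$ be a simple graph on $n$ vertices such that $G$ and its complement $\overline{G}$ are both connected. If $n\in\{4,5\}$ then $rc(G)+rc(\overline{G})\geq 6$, and if $n\in\{6,7\}$ then $rc(G)+rc(\overline{G})\geq 5$. All these bounds are best possible: for each $n\in\{4,5\}$ there is such a $G$ with $rc(G)+rc(\overline{G})=6$, and for each $n\in\{6,7\}$ there is such a $G$ with $rc(G)+rc(\overline{G})=5$.
   Context: All graphs are simple, finite and undirected. For a connected graph $G$, an edge coloring $c:E(G)\to\{1,\dots,k\}$ (adjacent edges may receive the same color) makes $G$ rainbow connected if for every two vertices $u,v$ there is a $u$–$v$ path whose edges have pairwise distinct colors; $rc(G)$ is the minimum such $k$. $\overline{G}$ denotes the complement of $G$. *)

(* Defs.v *)
From mathcomp Require Import all_boot.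
From mathcomp Require Import boolp.

Set Implicit Arguments.
Unset Strict Implicit.
Unset Printing Implicit Defensive.

Record sgraph := SGraph {
  vertex :> finType;
  adj : rel vertex;
  adj_sym : symmetric adj;
  adj_irrefl : irreflexive adj
}.

Section Complement.
Variable G : sgraph.

Definition compl_adj : rel G := fun u v => (u != v) && ~~ adj u v.

Lemma compl_adj_sym : symmetric compl_adj.
Proof. by move=> u v; rewrite /compl_adj eq_sym adj_sym. Qed.

Lemma compl_adj_irrefl : irreflexive compl_adj.
Proof. by move=> u; rewrite /compl_adj eqxx. Qed.

Definition compl : sgraph := SGraph compl_adj_sym compl_adj_irrefl.

End Complement.

Definition connected (G : sgraph) : Prop := forall u v : G, connect (@adj G) u v.

Section Rainbow.
Variable G : sgraph.

Definition edges : {set {set G}} :=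
  [set e | [exists u, exists v, adj u v && (e == [set u; v])]].

(* Only the values of [c] on [edges] matter. *)
Definition edge_coloring (k : nat) (c : {set G} -> nat) : Prop :=
  forall e, e \in edges -> 1 <= c e <= k.

(* The colors of the consecutive edges of the walk [u :: p]. *)
Definition walk_colors (c : {set G} -> nat) (u : G) (p : seq G) : seq nat :=
  pairmap (fun x y => c [set x; y]) u p.

Definition rainbow_path (c : {set G} -> nat) (u v : G) (p : seq G) : bool :=
  [&& path (@adj G) u p, last u p == v, uniq (u :: p)
    & uniq (walk_colors c u p)].

Definition rainbow_connected (c : {set G} -> nat) : Prop :=
  forall u v : G, exists p : seq G, rainbow_path c u v p.

Definition rainbow_colorable (k : nat) : Prop :=
  exists c : {set G} -> nat, edge_coloring k c /\ rainbow_connected c.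

(* The least [k] such that [rainbow_colorable k]; the junk value 0 is only
   taken when there is none, which by [rcP] requires [G] to be disconnected. *)
Definition rc : nat :=
  if pselect (exists k, `[< rainbow_colorable k >]) is left ex_k
  then ex_minn ex_k else 0.

Lemma connected_rainbow_colorable : connected G -> exists k, rainbow_colorable k.
Proof.
move=> Gconn; exists #|{: {set G}}|, (fun e => (enum_rank e).+1); split.
  by move=> e _ /=; rewrite ltn_ord.
move=> u v; have /connectP[p0 p0P ->] := Gconn u v.
case/shortenP: p0P => p pP p_uniq _; exists p.
rewrite /rainbow_path pP eqxx p_uniq /=.
elim: p u pP p_uniq {p0} => //= x p IHp u /andP[_ xp] /andP[u_notin xp_uniq].
rewrite IHp // andbT; apply/negP => /(nthP 0)[i]; rewrite size_pairmap => lt_i.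
rewrite (nth_pairmap x) // => -[/ord_inj/enum_rank_inj eq_ux].
have: u \in [set nth x (x :: p) i; nth x p i] by rewrite eq_ux set21.
rewrite !inE => /orP[] /eqP eq_u; move: u_notin; rewrite eq_u.
  by rewrite mem_nth //= ltnW.
by rewrite inE mem_nth // orbT.
Qed.

Lemma rcP : connected G ->
  rainbow_colorable rc /\ forall k, rainbow_colorable k -> rc <= k.
Proof.
move=> /connected_rainbow_colorable[k kP]; rewrite /rc.
case: pselect => [ex_k|[]]; last by exists k; apply/asboolP.
case: ex_minnP => m /asboolP mP m_min; split=> // j jP.
by apply: m_min; apply/asboolP.
Qed.

End Rainbow.

(* Main.v *)
Require Import Defs.
From mathcomp Require Import all_boot.
From mathcomp Require Import boolp zify.

(** Since [G] and its complement are both connected, neither is complete, so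
    both have rainbow connection number at least 2. A rainbow path uses at most
    as many edges as there are colors.

    On 6 or 7 vertices it remains to exclude that both numbers are 2. Color
    every pair of vertices by its side ([G] or the complement) and one of the
    two colors of that side: then the ends of every pair have a common neighbor
    on the other side, seen in different colors. By parity of the degree sum,
    some vertex has degree at most 2 on one of the sides; starting from the row
    of this vertex, sorted by relabelling, an exhaustive search finds no such
    coloring.

    On 4 or 5 vertices it remains to exclude 2 for [G] and at most 3 for the
    complement. It is enough to know that non-adjacent vertices have a common
    neighbor seen in different colors and that adjacent ones are at distance at
    most 3 in the complement; no 2-colored graph does this. *)

Set Implicit Arguments.
Unset Strict Implicit.
Unset Printing Implicit Defensive.

(** * Symmetric color tables and the search on 4 and 5 vertices *)

Fixpoint words (T : Type) (A : seq T) (m : nat) : seq (seq T) :=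
  if m is k.+1 then [seq x :: w | x <- A, w <- words A k] else [:: [::]].

Lemma mem_words (T : eqType) (A w : seq T) :
  {subset w <= A} -> w \in words A (size w).
Proof.
elim: w => //= x w IHw wA; apply: allpairs_f.
  by apply: wA; rewrite mem_head.
by apply: IHw => y wy; apply: wA; rewrite inE wy orbT.
Qed.

Fixpoint triangles (T : Type) (A : seq T) (n : nat) : seq (seq (seq T)) :=
  if n is m.+1 then [seq rcons M r | M <- triangles A m, r <- words A m]
  else [:: [::]].

Lemma mem_triangles (T : eqType) (A : seq T) (g : nat -> nat -> T) (n : nat) :
  (forall i j, g i j \in A) ->
  mkseq (fun i => mkseq (g i) i) n \in triangles A n.
Proof.
move=> gA; elim: n => //= n IHn; rewrite /mkseq -addn1 iotaD map_cat cats1 /=.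
apply: allpairs_f => //; rewrite add0n.
rewrite -[in words A n](size_mkseq (g n) n); apply: mem_words.
by move=> _ /mapP[j _ ->]; apply: gA.
Qed.

(** Only the strict lower triangle is stored: a diagonal entry lies just past the end of its row and
    reads as the default 0, that is, non-adjacent. *)
Definition entry (M : seq (seq nat)) (i j : nat) : nat :=
  nth 0 (nth [::] M (maxn i j)) (minn i j).

Lemma entryC (M : seq (seq nat)) (i j : nat) : entry M i j = entry M j i.
Proof. by rewrite /entry maxnC minnC. Qed.

Lemma entry_mkseq (g : nat -> nat -> nat) (n i j : nat) :
  (forall i j, g i j = g j i) -> (forall i, g i i = 0) -> i < n -> j < n ->
  entry (mkseq (fun i => mkseq (g i) i) n) i j = g i j.
Proof.
move=> gC g0; wlog le_ji : i j / j <= i => [IH lt_in lt_jn|lt_in _].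
  by case: (leqP j i) => [|/ltnW] le; [|rewrite entryC gC]; apply: IH.
rewrite /entry (maxn_idPl le_ji) (minn_idPr le_ji) nth_mkseq //.
move: le_ji; rewrite leq_eqVlt => /predU1P[->|lt_ji]; last by rewrite nth_mkseq.
by rewrite nth_default ?size_mkseq.
Qed.

(* These stop early even when evaluated by value, unlike [has] and [all], whose
   [||] and [&&] are then strict. *)
Fixpoint exists_lt (n : nat) (p : pred nat) : bool :=
  if n is m.+1 then if p m then true else exists_lt m p else false.

Fixpoint forall_lt (n : nat) (p : pred nat) : bool :=
  if n is m.+1 then if p m then forall_lt m p else false else true.

Lemma exists_ltP (n : nat) (p : pred nat) :
  reflect (exists2 i, i < n & p i) (exists_lt n p).
Proof.
elim: n => /= [|n IHn]; first by constructor; case.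
case p_n: (p n); first by constructor; exists n.
apply: (iffP IHn) => -[i lt_in p_i]; exists i => //; first exact: ltnW.
by move: lt_in; rewrite ltnS leq_eqVlt => /orP[/eqP eq_in|//]; rewrite eq_in p_n in p_i.
Qed.

Lemma forall_ltP (n : nat) (p : pred nat) :
  reflect (forall i, i < n -> p i) (forall_lt n p).
Proof.
elim: n => /= [|n IHn]; first by constructor.
case p_n: (p n); last by constructor => /(_ n (ltnSn n)); rewrite p_n.
apply: (iffP IHn) => p_lt i lt_in; last by apply/p_lt/ltnW.
by move: lt_in; rewrite ltnS leq_eqVlt => /orP[/eqP->|/p_lt].
Qed.

(* [q] is 0 on non-adjacent vertices, and in particular on the diagonal, so that
   walks of length exactly 3 in the complement may pause. *)
Definition feasible (n : nat) (q : nat -> nat -> nat) : bool :=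
  forall_lt n (fun i => forall_lt i (fun j =>
    if q i j is 0 then
      exists_lt n (fun w => match q i w, q w j with
                           | 1, 2 | 2, 1 => true
                           | _, _ => false
                           end)
    else
      exists_lt n (fun x => if q i x is 0 then
        exists_lt n (fun y => if q x y is 0 then
          if q y j is 0 then true else false else false) else false))).

(** Value 0 stands for no edge, 1 and 2 for the colors, so all [3 ^ 6] tables are tried, and
    [3 ^ 10] on five vertices. *)
Lemma infeasible4 :
  ~~ has (fun M => feasible 4 (entry M)) (triangles (iota 0 3) 4).
Proof. by vm_compute. Qed.
Lemma infeasible5 :
  ~~ has (fun M => feasible 5 (entry M)) (triangles (iota 0 3) 5).
Proof. by vm_compute. Qed.

(** * The search on 6 and 7 vertices *)

(* A pair in the graph has first component [true]; the second one is its color. *)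
Local Notation color := (bool * bool)%type.
(* A symmetric matrix of colors, where [None] marks an unknown entry. *)
Local Notation partial := (seq (seq (option color))).

Definition colors : seq color :=
  [:: (true, true); (true, false); (false, true); (false, false)].

Definition witnessed (A : Type) (f : A -> A -> color) (u v w : A) : bool :=
  [&& (f u w).1 == ~~ (f u v).1, (f v w).1 == ~~ (f u v).1
    & (f u w).2 != (f v w).2].

Definition agrees (M : partial) (g : nat -> nat -> color) : Prop :=
  forall i j c, nth None (nth [::] M i) j = Some c -> g i j = c.

(* The candidates for the common neighbor of a pair on side [k] whose rows are
   [r] and [s], each with the color of its edge to the first end; [None] if the
   known entries already provide a common neighbor. *)
Fixpoint witnesses (k : bool) (w n : nat) (r s : seq (option color)) :
    option (seq (nat * bool)) :=
  if n is m.+1 then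
    let cands :=
      match head None r, head None s with
      | None, None => Some [:: (w, true); (w, false)]
      | Some (a, p), None => Some (if a (+) k then [:: (w, p)] else [::])
      | None, Some (b, q) => Some (if b (+) k then [:: (w, ~~ q)] else [::])
      | Some (a, p), Some (b, q) =>
        if a (+) k then if b (+) k then if p (+) q then None
        else Some [::] else Some [::] else Some [::]
      end in
    if cands is Some l then
      if witnesses k w.+1 m (behead r) (behead s) is Some ws then Some (l ++ ws)
      else None
    else None
  else Some [::].

(** A vertex is passed over only when a known entry lies on the wrong side or both known colors
    agree, so no true witness is missed. The offset [w] is the number of columns already
    consumed. *)
Lemma mem_witnesses (k : bool) (w n : nat) (r s : seq (option color))
    (a b : nat -> color) (ws : seq (nat * bool)) (t : nat) :
  (forall i c, nth None r i = Some c -> a (w + i) = c) ->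
  (forall i c, nth None s i = Some c -> b (w + i) = c) ->
  witnesses k w n r s = Some ws -> t < n ->
  (a (w + t)).1 = ~~ k -> (b (w + t)).1 = ~~ k -> (a (w + t)).2 != (b (w + t)).2 ->
  (w + t, (a (w + t)).2) \in ws.
Proof.
elim: n w r s ws t => //= n IHn w r s ws t ra sb.
have {}IHn ws' i : witnesses k w.+1 n (behead r) (behead s) = Some ws' -> i < n ->
    (a (w + i.+1)).1 = ~~ k -> (b (w + i.+1)).1 = ~~ k ->
    (a (w + i.+1)).2 != (b (w + i.+1)).2 -> (w + i.+1, (a (w + i.+1)).2) \in ws'.
  rewrite -addSnnS; apply: IHn => j c; rewrite nth_behead addSnnS.
    exact: ra.
  exact: sb.
have := ra 0; have := sb 0; rewrite !nth0 addn0.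
set cands := (X in if X is Some _ then _ else _) => sb0 ra0.
case Ecands: cands => [l|//]; case Ews: witnesses => [ws'|//] [<-].
case: t => [_|t lt_tn] ak bk ab; rewrite mem_cat; last by rewrite (IHn ws') ?orbT.
apply/orP; left; move: Ecands ak bk ab; rewrite /cands addn0 => {cands}.
case: (head None r) ra0 => [[a1 a2]|] ra0; case: (head None s) sb0 => [[b1 b2]|] sb0;
  rewrite ?(ra0 _ erefl) ?(sb0 _ erefl) {ra0 sb0 Ews IHn} /=.
- by case: k a1 a2 b1 b2 => -[] [] [] [].
- by case: k a1 => -[] // [<-] _ _ _; rewrite mem_head.
- by case: k b1 (a w) b2 => -[] // [[] []] [] // [<-] _ _ _; rewrite mem_head.
- by case: (a w) => ? [] [<-]; rewrite !inE eqxx ?orbT.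
Qed.

(** [None] means that the pair is settled and offers no branching, whereas an empty list is a
    contradiction. *)
Definition options (n : nat) (M : partial) (i j : nat) :
    option (seq (seq (nat * nat * color))) :=
  let r := nth [::] M i in
  if nth None r j is Some (k, _) then
    if witnesses k 0 n r (nth [::] M j) is Some ws then
      Some [seq [:: (i, v.1, (~~ k, v.2)); (j, v.1, (~~ k, ~~ v.2))] | v <- ws]
    else None
  else Some [seq [:: (i, j, c)] | c <- colors].

Definition exhaustive (g : nat -> nat -> color)
    (b : seq (seq (nat * nat * color))) : Prop :=
  exists2 mv, mv \in b & all (fun a => g a.1.1 a.1.2 == a.2) mv.

Lemma options_exhaustive (n : nat) (M : partial) (g : nat -> nat -> color)
    (i j : nat) (b : seq (seq (nat * nat * color))) :
  agrees M g -> (exists2 w, w < n & witnessed g i j w) ->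
  options n M i j = Some b -> exhaustive g b.
Proof.
move=> Mg [w lt_wn /and3P[/eqP iw /eqP jw ne_ij]]; rewrite /options.
case Mij: nth => [[k p]|] => [|[<-]]; last first.
  exists [:: (i, j, g i j)]; last by rewrite /= eqxx.
  have /(map_f (fun c => [:: (i, j, c)])) : g i j \in colors by case: (g i j) => -[] [].
  by [].
rewrite (Mg _ _ _ Mij) /= in iw jw.
case Ews: witnesses => [ws|//] [<-].
exists [:: (i, w, (~~ k, (g i w).2)); (j, w, (~~ k, ~~ (g i w).2))]; last first.
  rewrite /=; case: (g i w) (g j w) iw jw ne_ij => [k1 p1] [k2 p2] /= -> ->.
  by rewrite !xpair_eqE !eqxx; case: p1 p2 => -[].
apply: (map_f (fun v => [:: (i, v.1, (~~ k, v.2)); (j, v.1, (~~ k, ~~ v.2))])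
  (x := (w, (g i w).2))).
by apply: (mem_witnesses (a := g i) (b := g j) _ _ Ews) => // l c /Mg.
Qed.

Fixpoint shorter (T : Type) (s t : seq T) : bool :=
  match s, t with
  | _, [::] => false
  | [::], _ => true
  | _ :: s', _ :: t' => shorter s' t'
  end.

(* Any list of moves returned by [options] would be sound; branching on a shortest
   one is what keeps the search small. *)
Fixpoint best (n : nat) (M : partial) (ps : seq (nat * nat))
    (acc : option (seq (seq (nat * nat * color)))) :=
  if ps is (i, j) :: ps' then
    if options n M i j is Some b then
      if b is [::] then Some b
      else best n M ps' (if acc is Some a then
                           if shorter b a then Some b else acc
                         else Some b)
    else best n M ps' acc
  else acc.

Lemma best_exhaustive (n : nat) (M : partial) (g : nat -> nat -> color)
    (ps : seq (nat * nat)) acc (b : seq (seq (nat * nat * color))) :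
  (forall i j b', (i, j) \in ps -> options n M i j = Some b' -> exhaustive g b') ->
  (forall b', acc = Some b' -> exhaustive g b') ->
  best n M ps acc = Some b -> exhaustive g b.
Proof.
elim: ps acc => [|[i j] ps IHps] acc psP accP /=; first exact: accP.
have {}IHps acc' : (forall b', acc' = Some b' -> exhaustive g b') ->
    best n M ps acc' = Some b -> exhaustive g b.
  by apply: IHps => i' j' b' ps_ij; apply: psP; rewrite inE ps_ij orbT.
case Eb': options => [b'|]; last exact: IHps.
have b'P : exhaustive g b' by apply: psP Eb'; rewrite mem_head.
case: b' b'P {Eb'} => [|mv b'] b'P; first by case: b'P.
apply: IHps => b''; case: acc accP => [a|] accP; last by case=> <-.
by case: ifP => _ => [[<-]|/accP].
Qed.

Definition set_cell (M : partial) (i j : nat) (c : color) : partial :=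
  set_nth [::] M i (set_nth None (nth [::] M i) j (Some c)).

Lemma agrees_set_cell (M : partial) (g : nat -> nat -> color) (i j : nat) :
  agrees M g -> agrees (set_cell M i j (g i j)) g.
Proof.
move=> Mg i' j' c; rewrite nth_set_nth /=; case: eqP => [->|_]; last exact: Mg.
by rewrite nth_set_nth /=; case: eqP => [-> [<-]|_ /Mg].
Qed.

Definition apply_move (M : partial) (mv : seq (nat * nat * color)) : partial :=
  foldr (fun a N => let: (i, j, c) := a in set_cell (set_cell N i j c) j i c) M mv.

Lemma agrees_apply_move (M : partial) (g : nat -> nat -> color)
    (mv : seq (nat * nat * color)) :
  (forall i j, g i j = g j i) -> agrees M g ->
  all (fun a => g a.1.1 a.1.2 == a.2) mv -> agrees (apply_move M mv) g.
Proof.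
move=> gC Mg; elim: mv => //= -[[i j] c] mv IHmv /= /andP[/eqP<- /IHmv ?].
by rewrite {2}gC; do 2!apply: agrees_set_cell.
Qed.

Definition pairs (n : nat) : seq (nat * nat) :=
  [seq (i, j) | i <- iota 0 n, j <- iota 0 i].

(** Running out of fuel or of pairs to branch on gives [false], so a positive answer is sound
    whatever the fuel. *)
Fixpoint refute (fuel n : nat) (M : partial) : bool :=
  if fuel is fuel'.+1 then
    if best n M (pairs n) None is Some b then
      all (fun mv => refute fuel' n (apply_move M mv)) b
    else false
  else false.

(** At each node [g] follows one of the moves, and the resulting table still agrees with [g]; by
    induction on the fuel that branch cannot be refuted. *)
Lemma refuteP (fuel n : nat) (M : partial) (g : nat -> nat -> color) :
  (forall i j, g i j = g j i) ->
  (forall i j, i < n -> j < n -> i != j -> exists2 w, w < n & witnessed g i j w) ->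
  agrees M g -> ~~ refute fuel n M.
Proof.
move=> gC gP; elim: fuel M => //= fuel IHfuel M Mg.
case Eb: best => [b|//].
have [] : exhaustive g b.
  apply: best_exhaustive Eb => // i j b' /allpairsPdep[i' [j' [+ + [-> ->]]]].
  rewrite !mem_iota !add0n /= => lt_i'n lt_j'i'.
  by apply: options_exhaustive => //; apply: gP; rewrite ?gtn_eqF // (ltn_trans lt_j'i').
move=> mv b_mv mvP; apply/negP => /allP /(_ mv b_mv); apply/negP/IHfuel.
exact: agrees_apply_move.
Qed.

Definition start (w : seq color) : partial :=
  (None :: map Some w) :: [seq Some c :: nseq (size w) None | c <- w].

Lemma agrees_start (g : nat -> nat -> color) (n : nat) :
  (forall i j, g i j = g j i) -> agrees (start (mkseq (fun i => g 0 i.+1) n)) g.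
Proof.
move=> gC [|i] [|j] c //=.
  case: (ltnP j n) => [lt_jn|le_nj]; last by rewrite nth_default // !size_map size_iota.
  by rewrite (nth_map (false, false)) ?size_mkseq // nth_mkseq // => -[].
all: case: (ltnP i n) => [lt_in|le_ni]; last by
  rewrite (@nth_default _ [::]) ?nth_nil // !size_map size_iota.
all: rewrite (nth_map (false, false)) ?size_mkseq // nth_mkseq //=.
  by case=> <-; rewrite gC.
by rewrite nth_nseq if_same.
Qed.

Definition code (c : color) : nat := c.1.*2 + c.2.

(** Sorting leaves one row for each multiset of colors. *)
Definition first_row (w : seq color) : bool :=
  sorted (relpre code leq) w && (count fst w <= 2).

(** Every move fills at least one unknown pair, so fuel ['C(n, 2)] suffices. *)
Definition refuted (n : nat) : bool :=
  all (fun w => refute 'C(n, 2) n (start w)) (filter first_row (words colors n.-1)).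

Lemma refuted6 : refuted 6.
Proof. by vm_compute. Qed.

Lemma refuted7 : refuted 7.
Proof. by vm_compute. Qed.

(** * A vertex of small degree, to start the search from *)

(** The handshake lemma: swapping the ends matches the pairs increasing in [enum_rank] with the
    decreasing ones, and the diagonal contributes nothing. *)
Lemma odd_sum_degrees (T : finType) (e : rel T) :
  symmetric e -> irreflexive e -> ~~ odd (\sum_x #|e x|).
Proof.
move=> eC eI; pose lt (p : T * T) := enum_rank p.1 < enum_rank p.2.
have -> : \sum_x #|e x| = \sum_(p : T * T) e p.1 p.2.
  rewrite -(pair_bigA _ (fun x y => nat_of_bool (e x y))) /=.
  by apply: eq_bigr => x _; rewrite -sum1_card big_mkcond.
rewrite (bigID lt) /= [X in _ + X](_ : _ = \sum_(p | lt p) e p.1 p.2).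
  by rewrite addnn odd_double.
have swap_inj : injective (fun p : T * T => (p.2, p.1)) by move=> [x y] [z t] [-> ->].
rewrite (reindex_inj swap_inj) /= big_mkcond [RHS]big_mkcond /=.
apply: eq_bigr => -[x y] _ /=; rewrite /lt /= eC -leqNgt.
by case: ltngtP => // /val_inj/enum_rank_inj->; rewrite eI.
Qed.

Definition interleaved (T : eqType) (f : T -> T -> color) : Prop :=
  forall u v, u != v -> exists w, witnessed f u v w.

(** Numbering [x0] first and the other vertices by their color towards [x0] turns [f] into a table
    whose first row the search has covered. *)
Lemma refuted_not_interleaved (T : finType) (f : T -> T -> color) (x0 : T) (n : nat) :
  #|T| = n.+1 -> refuted n.+1 -> (forall x y, f x y = f y x) ->
  #|[pred y | (y != x0) && (f x0 y).1]| <= 2 -> ~ interleaved f.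
Proof.
move=> T_n /allP n_refuted fC x0_deg fP.
pose r := sort (relpre (f x0) (relpre code leq)) (enum (predC1 x0)).
have r_perm : perm_eq r (enum (predC1 x0)) by rewrite perm_sort.
have r_n : size r = n.
  by rewrite (perm_size r_perm) -cardE cardC1 T_n.
have r_mem w : w \in x0 :: r.
  by rewrite inE (perm_mem r_perm) mem_enum !inE orbN.
have r_uniq : uniq (x0 :: r).
  by rewrite /= (perm_uniq r_perm) enum_uniq (perm_mem r_perm) mem_enum !inE eqxx.
pose g i j := f (nth x0 (x0 :: r) i) (nth x0 (x0 :: r) j).
have gC i j : g i j = g j i by apply: fC.
have row_g : mkseq (fun i => g 0 i.+1) n = map (f x0) r.
  by rewrite -[in RHS](mkseq_nth x0 r) r_n /mkseq -map_comp.
have : refute 'C(n.+1, 2) n.+1 (start (mkseq (fun i => g 0 i.+1) n)).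
  apply: n_refuted; rewrite mem_filter row_g; apply/andP; split.
    rewrite /first_row sorted_map sort_sorted /=; last by move=> x y; apply: leq_total.
    rewrite count_map (permP r_perm) -size_filter.
    rewrite -(card_uniqP (filter_uniq _ (enum_uniq _))); apply: leq_trans x0_deg.
    by apply/eq_leq/eq_card => y; rewrite mem_filter mem_enum !inE andbC.
  rewrite /= -[X in words _ X]r_n -(size_map (f x0)); apply: mem_words => c _.
  by case: c => -[] [].
apply/negP; apply: (@refuteP _ _ _ g) => //; last exact: agrees_start.
move=> i j lt_in lt_jn ne_ij.
have [|w] := fP (nth x0 (x0 :: r) i) (nth x0 (x0 :: r) j).
  by rewrite nth_uniq //= r_n.
exists (index w (x0 :: r)); first by rewrite -r_n -[(size r).+1]/(size (x0 :: r)) index_mem.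
by rewrite /witnessed /g nth_index.
Qed.

Lemma not_interleaved67 (T : finType) (f : T -> T -> color) :
  #|T| = 6 \/ #|T| = 7 -> (forall x y, f x y = f y x) -> ~ interleaved f.
Proof.
move=> T67 fC fP.
pose deg x := #|[pred y | (y != x) && (f x y).1]|.
pose codeg x := #|[pred y | (y != x) && ~~ (f x y).1]|.
have degD x : deg x + codeg x = #|T|.-1.
  rewrite -(cardC1 x) -(cardID [pred y | (f x y).1]); congr (_ + _).
  by apply: eq_card => y; rewrite !inE andbC.
(* On 6 vertices the two degrees add up to 5. On 7 they add up to 6, and if both always exceeded 2,
   all would be 3, with the odd sum 21. *)
have [x0 small] : exists x, (deg x <= 2) || (codeg x <= 2).
  apply/existsP; rewrite -[X in is_true X]negbK negb_exists; apply/negP => /forallP big.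
  have {}big x : 2 < deg x /\ 2 < codeg x.
    by apply/andP; have := big x; rewrite negb_or -!ltnNge.
  have /card_gt0P[x _] : 0 < #|T| by case: T67 => ->.
  case: T67 => T_n; first by have := degD x; case: (big x); rewrite T_n; lia.
  have := @odd_sum_degrees T (fun x y => (y != x) && (f x y).1).
  rewrite (eq_bigr (fun _ => 3)) => [|y _]; last first.
    by have := degD y; case: (big y); rewrite T_n /deg; set d := #|_|; lia.
  rewrite sum_nat_const T_n => /(_ _ _)/negP; apply=> // [y z|y].
    by rewrite eq_sym fC.
  by rewrite eqxx.
have T_refuted : refuted #|T|.-1.+1.
  by case: T67 => ->; [apply: refuted6 | apply: refuted7].
have T_n : #|T| = #|T|.-1.+1 by case: T67 => ->.
case/orP: small => small; first exact: (refuted_not_interleaved T_n T_refuted fC small fP).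
(* Being interleaved is invariant under exchanging the two sides. *)
pose f' x y := (~~ (f x y).1, (f x y).2).
apply: (@refuted_not_interleaved _ f' x0 _ T_n) => //.
  by move=> x y; rewrite /f' fC.
move=> u v /fP[w uvw]; exists w; move: uvw; rewrite /witnessed /f' /=.
by case: (f u v).1 (f u w).1 (f v w).1 => -[] [].
Qed.

(** * What two or three colors force on a graph *)

Lemma eq_sgraph (T : finType) (e e' : rel T) (eC : symmetric e) (eI : irreflexive e)
    (eC' : symmetric e') (eI' : irreflexive e') :
  e =2 e' -> SGraph eC eI = SGraph eC' eI'.
Proof.
move=> eq_ee'; have eq_e : e = e' by apply/funext => u; apply/funext => v.
by subst e'; congr SGraph; apply: Prop_irrelevance.
Qed.

(** An equality rather than an isomorphism, so that results can be applied with the two graphs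
    exchanged. *)
Lemma complK (G : sgraph) : compl (compl G) = G.
Proof.
case: G => T e eC eI; apply: eq_sgraph => u v; rewrite /compl_adj /= /compl_adj /=.
by case: eqVneq => [->|_]; rewrite ?eI ?negbK.
Qed.

Lemma rainbow_colorableW (G : sgraph) (k k' : nat) :
  k <= k' -> rainbow_colorable G k -> rainbow_colorable G k'.
Proof.
move=> le_k [c [cP c_rainbow]]; exists c; split=> // e /cP /andP[-> /leq_trans]; exact.
Qed.

Lemma mem_edges (G : sgraph) (u v : G) : adj u v -> [set u; v] \in edges G.
Proof.
by move=> uv; rewrite inE; apply/existsP; exists u; apply/existsP; exists v; rewrite uv /=.
Qed.

Lemma mem_walk_colors (G : sgraph) (k : nat) (c : {set G} -> nat) (u : G) (p : seq G) :
  edge_coloring k c -> path (@adj G) u p ->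
  {subset walk_colors c u p <= iota 1 k}.
Proof.
move=> cP; elim: p u => //= v p IHp u /andP[uv vp] i; rewrite inE => /predU1P[->|].
  by have := cP _ (mem_edges uv); rewrite mem_iota add1n ltnS.
exact: IHp.
Qed.

Lemma size_rainbow_path (G : sgraph) (k : nat) (c : {set G} -> nat) (u v : G) (p : seq G) :
  edge_coloring k c -> rainbow_path c u v p -> size p <= k.
Proof.
move=> cP /and4P[pP _ _ p_uniq].
have := uniq_leq_size p_uniq (mem_walk_colors cP pP).
by rewrite size_iota size_pairmap.
Qed.

Lemma rainbow_colorable1 (G : sgraph) (u v : G) :
  rainbow_colorable G 1 -> u != v -> adj u v.
Proof.
case=> c [cP /(_ u v)[p puv]]; have := size_rainbow_path cP puv.
case/and4P: puv; case: p => [|w [|//]] /=; first by move=> _ /eqP->; rewrite eqxx.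
by rewrite andbT => uw /eqP<-.
Qed.

Lemma rainbow_colorable2 (G : sgraph) :
  rainbow_colorable G 2 -> exists c : {set G} -> bool,
  forall u v : G, u != v -> ~~ adj u v ->
    exists w, [/\ adj u w, adj v w & c [set u; w] != c [set v; w]].
Proof.
(* The colors are 1 and 2, so testing for 1 tells them apart. *)
case=> c [cP c_rainbow]; exists (fun e => c e == 1) => u v ne_uv uv.
have [p puv] := c_rainbow u v; have := size_rainbow_path cP puv.
case/and4P: puv; case: p => [|w [|w' [|//]]] /=.
- by move=> _ /eqP eq_uv; rewrite eq_uv eqxx in ne_uv.
- by rewrite andbT => uw /eqP eq_wv; rewrite eq_wv (negPf uv) in uw.
rewrite !andbT inE => /andP[uw ww'] /eqP eq_w'v _ c_uv _.
rewrite eq_w'v in ww' c_uv; exists w; rewrite (adj_sym v) /=; split=> //.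
rewrite (setUC [set v]); apply: contraNneq c_uv.
have := cP _ (mem_edges uw); have := cP _ (mem_edges ww').
by case: (c [set u; w]) (c [set w; v]) => [|[|[|]]] // [|[|[|]]].
Qed.

(** Only the length of the rainbow path matters; a shorter one is padded by repeating [u], which is
    non-adjacent to itself. *)
Lemma rainbow_colorable3 (G : sgraph) (u v : G) :
  rainbow_colorable (compl G) 3 ->
  exists x y, [/\ ~~ adj u x, ~~ adj x y & ~~ adj y v].
Proof.
case=> c [cP /(_ u v)[p puv]]; have := size_rainbow_path cP puv.
case/and4P: puv => pP /eqP <- _ _ {cP}.
case: p pP => [|x [|y [|z [|//]]]] /=; rewrite /compl_adj /= ?andbT.
- by move=> _ _; exists u, u; rewrite adj_irrefl.
- by case/andP=> _ ux _; exists u, u; rewrite adj_irrefl.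
- by case/andP=> /andP[_ ux] /andP[_ xy] _; exists u, x; rewrite adj_irrefl.
- by case/and3P=> /andP[_ ux] /andP[_ xy] /andP[_ yz] _; exists x, y.
Qed.

(** With one color all pairs are adjacent, leaving no edge to begin a path in the complement. *)
Lemma rc_gt1 (G : sgraph) :
  1 < #|G| -> connected G -> connected (compl G) -> 1 < rc G.
Proof.
move=> G_gt1 /rcP[G_rc _] coG_conn; rewrite ltnNge; apply/negP => rc_le1.
have {G_rc rc_le1} G_complete := rainbow_colorable1 (rainbow_colorableW rc_le1 G_rc).
have /card_gt1P[u [v [_ _ ne_uv]]] := G_gt1.
have /connectP[[|w p] /=] := coG_conn u v.
  by move=> _ eq_vu; rewrite eq_vu eqxx in ne_uv.
by case/andP => /andP[/G_complete ->].
Qed.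

Lemma not_rainbow_colorable_2_3 (G : sgraph) :
  #|G| = 4 \/ #|G| = 5 -> rainbow_colorable G 2 -> ~ rainbow_colorable (compl G) 3.
Proof.
move=> G45 /rainbow_colorable2[c cP] coG3.
have /card_gt0P[x0 _] : 0 < #|G| by case: G45 => ->.
pose v i : G := nth x0 (enum G) i.
have vP x : exists2 i, i < #|G| & v i = x.
  have Gx : x \in enum G by rewrite mem_enum.
  by exists (index x (enum G)); rewrite /v ?nth_index // cardE index_mem.
(* The successor maps the boolean colors to 1 and 2, keeping 0 for non-adjacent vertices. *)
pose g i j := if adj (v i) (v j) then (c [set v i; v j]).+1 else 0.
have gC i j : g i j = g j i by rewrite /g adj_sym setUC.
have g_adj i j : (g i j == 0) = ~~ adj (v i) (v j) by rewrite /g; case: adj.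
pose M := mkseq (fun i => mkseq (g i) i) #|G|.
have entryM i j : i < #|G| -> j < #|G| -> entry M i j = g i j.
  by apply: entry_mkseq => // k; rewrite /g adj_irrefl.
have M_feasible : feasible #|G| (entry M).
  apply/forall_ltP => i lt_i; apply/forall_ltP => j lt_ji.
  have lt_j := ltn_trans lt_ji lt_i; rewrite entryM //.
  case Eij: (g i j) => [|l].
    have [] := cP (v i) (v j).
    - by rewrite /v nth_uniq ?enum_uniq -?cardE // gtn_eqF.
    - by rewrite -g_adj Eij.
    move=> w; have [k lt_k <-] := vP w => -[ik jk c_ne].
    apply/exists_ltP; exists k; rewrite // !entryM // (gC k) /g ik jk.
    by case: (c _) (c _) c_ne => -[].
  have [x [y]] := rainbow_colorable3 (v i) (v j) coG3.
  have [k lt_k <-] := vP x; have [m lt_m <-] := vP y.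
  rewrite -!g_adj => -[/eqP ik /eqP km /eqP mj].
  apply/exists_ltP; exists k; rewrite // entryM // ik.
  by apply/exists_ltP; exists m; rewrite // !entryM // km mj.
have M_tri : M \in triangles (iota 0 3) #|G|.
  by apply: mem_triangles => i j; rewrite mem_iota /g; case: ifP => _ //; case: (c _).
case: G45 => G_n; rewrite G_n in M_feasible M_tri.
  by have /hasPn/(_ M M_tri)/negP := infeasible4; apply.
by have /hasPn/(_ M M_tri)/negP := infeasible5; apply.
Qed.

Lemma not_rainbow_colorable_2_2 (G : sgraph) :
  #|G| = 6 \/ #|G| = 7 -> rainbow_colorable G 2 -> ~ rainbow_colorable (compl G) 2.
Proof.
move=> G67 /rainbow_colorable2[c cP] /rainbow_colorable2[d dP].
pose f (u v : G) := (adj u v, if adj u v then c [set u; v] else d [set u; v]).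
apply: (@not_interleaved67 G f) => // [x y|u v ne_uv].
  by rewrite /f adj_sym setUC.
rewrite /witnessed /f /=; case uv: (adj u v).
  have [|w [/andP[_ /negPf uw] /andP[_ /negPf vw] dw]] := dP u v ne_uv.
    by rewrite /= /compl_adj uv andbF.
  by exists w; rewrite uw vw.
have [|w [uw vw cw]] := cP u v ne_uv; first by rewrite uv.
by exists w; rewrite uw vw.
Qed.

(** * The lower bounds *)

Section Lower.
Variable G : sgraph.
Hypotheses (G_conn : connected G) (coG_conn : connected (compl G)).

Lemma rc_sum_ge6 : #|G| = 4 \/ #|G| = 5 -> 6 <= rc G + rc (compl G).
Proof.
move=> G45; have G_gt1 : 1 < #|G| by case: G45 => ->.
have coG_gt1 : 1 < rc (compl G) by apply: rc_gt1; rewrite ?complK.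
have G_rc_gt1 := rc_gt1 G_gt1 G_conn coG_conn.
have [G_rc _] := rcP G_conn; have [coG_rc _] := rcP coG_conn.
rewrite leqNgt; apply/negP => lt6.
(* Both numbers are at least 2 and their sum is at most 5: one of them is 2 and the other at most
   3. *)
have [rc2|rc3] := leqP (rc G) 2.
  apply: (not_rainbow_colorable_2_3 G45 (rainbow_colorableW rc2 G_rc)).
  by apply: rainbow_colorableW coG_rc; lia.
apply: (@not_rainbow_colorable_2_3 (compl G)) => //.
  by apply: rainbow_colorableW coG_rc; lia.
by rewrite complK; apply: rainbow_colorableW G_rc; lia.
Qed.

Lemma rc_sum_ge5 : #|G| = 6 \/ #|G| = 7 -> 5 <= rc G + rc (compl G).
Proof.
move=> G67; have G_gt1 : 1 < #|G| by case: G67 => ->.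
have coG_gt1 : 1 < rc (compl G) by apply: rc_gt1; rewrite ?complK.
have G_rc_gt1 := rc_gt1 G_gt1 G_conn coG_conn.
have [G_rc _] := rcP G_conn; have [coG_rc _] := rcP coG_conn.
rewrite leqNgt; apply/negP => lt5.
apply: (not_rainbow_colorable_2_2 G67).
  by apply: rainbow_colorableW G_rc; lia.
by apply: rainbow_colorableW coG_rc; lia.
Qed.
End Lower.

(** * Graphs attaining the bounds *)

Lemma rainbow_colorable_connected (G : sgraph) (k : nat) :
  rainbow_colorable G k -> connected G.
Proof.
move=> [c [_ c_rainbow]] u v; have [p /and4P[pP /eqP <- _ _]] := c_rainbow u v.
by apply/connectP; exists p.
Qed.

(** By symmetry the value does not depend on the ordering of the ends that [pick] returns. *)
Lemma edge_function (T : finType) (q : T -> T -> nat) :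
  (forall x y, q x y = q y x) ->
  exists c : {set T} -> nat, forall x y, c [set x; y] = q x y.
Proof.
move=> qC.
exists (fun A => if [pick p | A == [set p.1; p.2]] is Some p then q p.1 p.2 else 0).
move=> x y; case: pickP => [[z t] /= /eqP eqA|/(_ (x, y))]; last by rewrite eqxx.
have hx : x \in [set z; t] by rewrite -eqA set21.
have hy : y \in [set z; t] by rewrite -eqA set22.
have /set2P hz : z \in [set x; y] by rewrite eqA set21.
have /set2P ht : t \in [set x; y] by rewrite eqA set22.
move: hx hy; case: hz ht => -> [] -> //; rewrite !inE ?orbb.
  by move=> _ /eqP->.
by move=> /eqP->.
Qed.

(** A counterpart of [rainbow_path] on numbers, which evaluates by computation. *)
Definition rainbow_walk (e : rel nat) (q : nat -> nat -> nat) (i j : nat) (p : seq nat) :=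
  [&& path e i p, last i p == j, uniq (i :: p) & uniq (pairmap q i p)].

(** Lengths 0 to 3 suffice, as the examples use at most three colors on each side. *)
Definition short_walks (n : nat) : seq (seq nat) :=
  flatten [seq words (iota 0 n) m | m <- iota 0 4].

Definition rainbow_check (n k : nat) (e : rel nat) (q : nat -> nat -> nat) : bool :=
  forall_lt n (fun i => forall_lt n (fun j =>
    (e i j ==> (0 < q i j <= k)) && has (rainbow_walk e q i j) (short_walks n))).

Lemma words_subset (T : eqType) (A w : seq T) (m : nat) :
  w \in words A m -> {subset w <= A}.
Proof.
elim: m w => [|m IHm] w /=; first by rewrite inE => /eqP->.
case/allpairsP=> -[x w'] /= [Ax /IHm w'A ->] y; rewrite inE => /predU1P[->|] //.
exact: w'A.
Qed.

Lemma rainbow_checkP (n k : nat) (e : rel 'I_n) (eC : symmetric e) (eI : irreflexive e)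
    (a : rel nat) (q : nat -> nat -> nat) :
  (forall i j, e i j = a i j) -> (forall i j, q i j = q j i) ->
  rainbow_check n k a q -> rainbow_colorable (SGraph eC eI) k.
Proof.
move=> ea qC qP.
have [c cP] := edge_function (fun x y : 'I_n => qC x y).
exists c; split=> [A|u v].
  rewrite inE => /existsP[u /existsP[v /andP[uv /eqP->]]]; rewrite cP.
  have /forall_ltP/(_ _ (ltn_ord u))/forall_ltP/(_ _ (ltn_ord v)) := qP.
  by case/andP=> /implyP + _; apply; rewrite -ea.
have /forall_ltP/(_ _ (ltn_ord u))/forall_ltP/(_ _ (ltn_ord v)) := qP.
case/andP=> _ /hasP[p /flatten_mapP[m _ /words_subset p_n]].
(* All entries of the walk are below [n], so it lifts to ordinals. *)
have [p' ->] : exists p' : seq 'I_n, p = map val p'.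
  exists (pmap insub p); rewrite pmap_filter; last exact: insubK.
  apply/esym/all_filterP/allP => i /p_n; rewrite mem_iota /= => lt_i.
  by rewrite insubT.
case/and4P=> pP p_last p_uniq p_colors; exists p'; apply/and4P; split.
- by move: pP; rewrite path_map; apply: sub_path => i j; rewrite /= ea.
- by rewrite -val_eqE /= -last_map.
- by rewrite -(map_inj_uniq val_inj).
suff -> : @walk_colors (SGraph eC eI) c u p' = pairmap q (u : 'I_n) (map val p') by [].
by elim: p' u {pP p_last p_uniq p_colors} => //= w p' IHp' u; rewrite cP IHp'.
Qed.

(* The entries of [M] from 1 to 3 are the colors of the edges of a graph, and
   those above 3, lowered by 3, the colors of the edges of its complement. *)
Definition example_check (n k l : nat) (M : seq (seq nat)) : bool :=
  rainbow_check n k (fun i j => (i != j) && (entry M i j <= 3)) (entry M) &&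
  rainbow_check n l (fun i j => (i != j) && (3 < entry M i j)) (fun i j => entry M i j - 3).

Lemma example_checkP (n k l : nat) (M : seq (seq nat)) :
  example_check n k l M ->
  exists G : sgraph, [/\ #|G| = n, connected G, connected (compl G)
    & rc G + rc (compl G) <= k + l].
Proof.
case/andP=> Mk Ml; pose e (i j : 'I_n) := (i != j) && (entry M i j <= 3).
have eC : symmetric e by move=> i j; rewrite /e eq_sym entryC.
have eI : irreflexive e by move=> i; rewrite /e eqxx.
have Gk : rainbow_colorable (SGraph eC eI) k.
  by apply: rainbow_checkP Mk => // i j; apply: entryC.
have coGl : rainbow_colorable (compl (SGraph eC eI)) l.
  apply: rainbow_checkP Ml => i j; last by rewrite entryC.
  by rewrite /compl_adj /= /e -val_eqE /=; case: eqP => //= _; rewrite -ltnNge.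
have [G_conn coG_conn] := (rainbow_colorable_connected Gk, rainbow_colorable_connected coGl).
exists (SGraph eC eI); split=> //; first exact: card_ord.
by apply: leq_add; [have [_] := rcP G_conn | have [_] := rcP coG_conn]; apply.
Qed.

(** The path 0, 1, 2, 3, which is self-complementary. *)
Lemma example4 : example_check 4 3 3 [:: [::]; [:: 1]; [:: 6; 2]; [:: 5; 4; 3]].
Proof. by vm_compute. Qed.

(** The 5-cycle, again self-complementary. *)
Lemma example5 :
  example_check 5 3 3 [:: [::]; [:: 1]; [:: 4; 2]; [:: 6; 5; 1]; [:: 3; 4; 5; 2]].
Proof. by vm_compute. Qed.

(** The complement is the hexagon 0, 2, 3, 1, 4, 5 with the chord from 2 to 5. *)
Lemma example6 :
  example_check 6 2 3
    [:: [::]; [:: 2]; [:: 4; 2]; [:: 1; 4; 5]; [:: 1; 4; 2; 1]; [:: 5; 1; 4; 2; 6]].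
Proof. by vm_compute. Qed.

(** The complement is the heptagon 0, 5, 4, 1, 3, 2, 6 with the chords from 0 to 4 and from 1 to
    2. *)
Lemma example7 :
  example_check 7 2 3
    [:: [::]; [:: 2]; [:: 1; 5]; [:: 2; 6; 4]; [:: 5; 4; 2; 2]; [:: 5; 2; 1; 1; 5];
        [:: 4; 2; 6; 1; 1; 2]].
Proof. by vm_compute. Qed.

Theorem theorem4 :
  (forall (n : nat) (G : sgraph),
      #|G| = n -> connected G -> connected (compl G) ->
      (n = 4 \/ n = 5 -> 6 <= rc G + rc (compl G)) /\
      (n = 6 \/ n = 7 -> 5 <= rc G + rc (compl G))) /\
  (forall n : nat, n = 4 \/ n = 5 ->
      exists G : sgraph,
        [/\ #|G| = n, connected G, connected (compl G)
          & rc G + rc (compl G) = 6]) /\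
  (forall n : nat, n = 6 \/ n = 7 ->
      exists G : sgraph,
        [/\ #|G| = n, connected G, connected (compl G)
          & rc G + rc (compl G) = 5]).
Proof.
split=> [n G <- G_conn coG_conn|].
  by split; [apply: rc_sum_ge6 | apply: rc_sum_ge5].
split=> n n_val.
  have [G [G_n G_conn coG_conn le6]] : exists G : sgraph,
      [/\ #|G| = n, connected G, connected (compl G) & rc G + rc (compl G) <= 6].
    by case: n_val => ->; [apply: example_checkP example4 | apply: example_checkP example5].
  exists G; split=> //; apply/eqP; rewrite eqn_leq le6 rc_sum_ge6 ?G_n //.
have [G [G_n G_conn coG_conn le5]] : exists G : sgraph,
    [/\ #|G| = n, connected G, connected (compl G) & rc G + rc (compl G) <= 5].
  by case: n_val => ->; [apply: example_checkP example6 | apply: example_checkP example7].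
by exists G; split=> //; apply/eqP; rewrite eqn_leq le5 rc_sum_ge5 ?G_n.
Qed.
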